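(* Let $D\subseteq W$ be a connected, ample and closed Condorcet domain and let $P=\varphi(D)$. Then $D$ is a maximal Condorcet domain if and only if for any covering relation $\alpha\lessdot\beta$ in $P$, there exists a root-triple containing $\alpha$ and $-\beta$.
   Context: Let $\Phi$ be a finite root system in a real Euclidean space (a finite set of nonzero vectors with $\Phi\cap\mathbb{R}\alpha=\{\alpha,-\alpha\}$ and $s_\alpha(\Phi)=\Phi$ for all $\alpha\in\Phi$, where $s_\alpha$ is the orthogonal reflection in $\alpha^\perp$; not necessarily crystallographic). Let $\Phi^+$ be a choice of positive roots, $\Phi^-=\Phi\setminus\Phi^+$, and let $W=W(\Phi)$ be the finite Coxeter group generated by the $s_\alpha$. For $w\in W$, the (left) inversion set is $I(w):=\{\alpha\in\Phi\mid w^{-1}\alpha\in\Phi^-\}$ (negative roots are allowed, so exactly one of $\alpha,-\alpha$ lies in $I(w)$). A set of three roots $\{\alpha,\beta,\gamma\}\subseteq\Phi$ is a root-triple if there exist real $a,b,c>0$ with $a\alpha+b\beta+c\gamma=0$. A nonempty subset $D\subseteq W$ is a Condorcet domain if there do not exist distinct $u,v,w\in D$ and a root-triple $\{\alpha,\beta,\gamma\}$ such that $\alpha,\beta\in I(u)$, $\alpha,\gamma\in I(v)$, $\beta,\gamma\in I(w)$. A Condorcet domain is maximal if it is not properly contained in another Condorcet domain in $W$. A voting profile on $D$ is a map $f:D\to\mathbb{Z}_{\ge0}$, not constantly zero. Put $f(\alpha)=\sum_{w\in D,\ \alpha\in I(w)}f(w)$ for $\alpha\in\Phi$, $|f|=\sum_{w\in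 D}f(w)$, $I(f)=\{\alpha\in\Phi\mid f(\alpha)\ge|f|/2\}$ and $R(f)=\{w\in W\mid I(w)\subseteq I(f)\}$. $f$ has no tie if $f(\alpha)\ne|f|/2$ for all $\alpha\in\Phi$. Let $\nu(D)=\bigcup_f R(f)$ over all voting profiles $f$ on $D$ with no tie. A Condorcet domain $D$ is closed if $\nu(D)=D$ (equivalently $\nu(D)\subseteq D$). $D$ is ample if there is no $\alpha\in\Phi$ with $\alpha\in I(v)$ for all $v\in D$. $D$ is connected if for any $u,v\in D$ there exist $m\ge0$ and a sequence $w_0=u,w_1,\dots,w_m=v$ in $D$ with $|I(w_{i+1})\setminus I(w_i)|=1$ for all $0\le i\le m-1$. For $\gamma\in\Phi$ let $D(\gamma)=\{v\in D\mid\gamma\in I(v)\}$; $\varphi(D)$ is the preposet (reflexive transitive relation) on $\Phi$ with $\alpha\le\beta$ if and only if $D(\alpha)\supseteq D(\beta)$. Here $\alpha<\beta$ means $\alpha\le\beta$ and not $\beta\le\alpha$, and $\alpha\lessdot\beta$ means $\alpha<\beta$ and there is no $\gamma$ with $\alpha<\gamma<\beta$. *)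

(* Defs.v *)
From HB Require Import structures.
From mathcomp Require Import all_boot all_order all_algebra.
From mathcomp Require Import finmap reals.

Set Implicit Arguments.
Unset Strict Implicit.
Unset Printing Implicit Defensive.

Import Order.TTheory GRing.Theory Num.Theory.

Local Open Scope fset_scope.
Local Open Scope ring_scope.

(* The Euclidean space is R^n, as column vectors with the standard inner
   product; isometries act on the left, [w *m v]. *)

Definition dotp (R : realType) (n : nat) (u v : 'cV[R]_n) : R :=
  \sum_(i < n) u i 0 * v i 0.

(* The matrix of v |-> v - 2 (a,v)/(a,a) a. *)
Definition refl (R : realType) (n : nat) (a : 'cV[R]_n) : 'M[R]_n :=
  1%:M - (2 / dotp a a) *: (a *m a^T).

Definition root_system (R : realType) (n : nat) (Phi : {fset 'cV[R]_n}) : Prop :=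
  [/\ forall a, a \in Phi -> a != 0,
      forall a, a \in Phi -> forall b,
        (b \in Phi /\ exists c : R, b = c *: a) <-> (b = a \/ b = - a)
    & forall a, a \in Phi -> [fset refl a *m b | b in Phi] = Phi].

Definition positive_system (R : realType) (n : nat)
    (Phi Phip : {fset 'cV[R]_n}) : Prop :=
  exists l : 'cV[R]_n,
    (forall a, a \in Phi -> dotp l a != 0) /\
    Phip = [fset a in Phi | 0 < dotp l a].

Inductive coxeter_group (R : realType) (n : nat) (Phi : {fset 'cV[R]_n}) :
    'M[R]_n -> Prop :=
| cox_one : coxeter_group Phi 1%:M
| cox_refl a : a \in Phi -> coxeter_group Phi (refl a)
| cox_mul u v : coxeter_group Phi u -> coxeter_group Phi v ->
    coxeter_group Phi (u *m v)
| cox_inv u : coxeter_group Phi u -> coxeter_group Phi (invmx u).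

Definition root_triple (R : realType) (n : nat) (Phi : {fset 'cV[R]_n})
    (a b c : 'cV[R]_n) : Prop :=
  [/\ [&& a \in Phi, b \in Phi & c \in Phi], uniq [:: a; b; c]
    & exists x y z : R,
        [/\ 0 < x, 0 < y, 0 < z & x *: a + y *: b + z *: c = 0]].

Section Domains.

Variables (R : realType) (n : nat) (Phi Phip : {fset 'cV[R]_n}).
Implicit Types (D E : {fset 'M[R]_n}) (a b c : 'cV[R]_n).

Definition inv_set (w : 'M[R]_n) : {fset 'cV[R]_n} :=
  [fset a in Phi | invmx w *m a \in Phi `\` Phip].

(* W is finite, so its subsets are exactly the finite sets of matrices all of
   whose elements lie in W. *)
Definition condorcet D : Prop :=
  [/\ D != fset0,
      forall w, w \in D -> coxeter_group Phi w
    & ~ exists u v w a b c,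
        [/\ [&& u \in D, v \in D & w \in D], uniq [:: u; v; w],
            root_triple Phi a b c
          & [/\ a \in inv_set u /\ b \in inv_set u,
                a \in inv_set v /\ c \in inv_set v
              & b \in inv_set w /\ c \in inv_set w]]].

Definition maximal_condorcet D : Prop :=
  condorcet D /\ ~ exists E, condorcet E /\ D `<` E.

(* A map D -> N is represented by a function on all matrices, only the values
   of which on D are ever used. *)
Definition voting_profile D (f : 'M[R]_n -> nat) : Prop :=
  exists2 w, w \in D & f w != 0%N.

Definition votes_for D (f : 'M[R]_n -> nat) a : nat :=
  (\sum_(w <- D | a \in inv_set w) f w)%N.

Definition total_votes D (f : 'M[R]_n -> nat) : nat := (\sum_(w <- D) f w)%N.

Definition majority_set D (f : 'M[R]_n -> nat) : {fset 'cV[R]_n} :=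
  [fset a in Phi | (total_votes D f)%:R / 2 <= (votes_for D f a)%:R :> rat].

Definition majority_result D (f : 'M[R]_n -> nat) (w : 'M[R]_n) : Prop :=
  coxeter_group Phi w /\ inv_set w `<=` majority_set D f.

Definition no_tie D (f : 'M[R]_n -> nat) : Prop :=
  forall a, a \in Phi ->
    (votes_for D f a)%:R != (total_votes D f)%:R / 2 :> rat.

Definition nu D (w : 'M[R]_n) : Prop :=
  exists f, [/\ voting_profile D f, no_tie D f & majority_result D f w].

Definition closed_domain D : Prop := forall w, nu D w <-> w \in D.

Definition ample D : Prop :=
  ~ exists2 a, a \in Phi & forall v, v \in D -> a \in inv_set v.

Definition connected_domain D : Prop :=
  forall u v, u \in D -> v \in D ->
    exists p : seq 'M[R]_n,
      [/\ {subset p <= D},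
          path (fun x y => #|` inv_set y `\` inv_set x | == 1%N) u p
        & last u p = v].

Definition dom_at D c : {fset 'M[R]_n} := [fset v in D | c \in inv_set v].

(* The preposet phi(D); its ground set is Phi. *)
Definition phi_le D a b : bool := dom_at D b `<=` dom_at D a.

Definition phi_lt D a b : bool := phi_le D a b && ~~ phi_le D b a.

Definition phi_covers D a b : Prop :=
  [/\ a \in Phi, b \in Phi, phi_lt D a b
    & ~ exists2 c, c \in Phi & phi_lt D a c && phi_lt D c b].

End Domains.

(* Main.v *)
Require Import Defs.
From mathcomp Require Import all_boot all_order all_algebra.
From mathcomp Require Import finmap reals boolp.
From mathcomp Require Import ring lra zify.

Import Order.TTheory GRing.Theory Num.Theory.

(** Write [N w] for the inversion set of [w] and [a <= b] for the relation
    [phi_le]: every [v] in [D] with [b] in [N v] has [a] in [N v].  Negation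
    reverses [<=], and [- a <= b] says that no member of [D] inverts both [a]
    and [b].  So a set [D] is Condorcet exactly when each root-triple contains
    two roots [a], [b] with [- a <= b] (lemma [condorcetP]).

    Two facts turn the theorem into order theory.  First, a set of roots that
    contains exactly one of [a], [- a] for every root [a] and contains no
    root-triple is an inversion set (lemma [half_triple_free_inv_set]).  One
    applies to it reflections in simple roots that it contains, which lowers
    the number of its positive roots; when it contains no simple root, the
    absence of root-triples pushes this up by height, and the set consists of
    all negative roots.  Secondly, a closed Condorcet domain contains every
    group element whose inversion set is an ideal for [<=] (lemma
    [closed_ideal]): a majority vote of three members is again a half-system
    without root-triple, so [D] is stable under majority, and a family stable
    under majority is determined by its traces on pairs.

    Connectedness and ampleness say that each root [c] is at some step of [D]
    the only root to be added to an inversion set (lemma [connected_flip]).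
    Hence [<=] is antisymmetric, and a root-triple [a, b, - c] cannot have
    both [a <= c] and [b <= c]: just before [c] is added, the triple would be
    contained in an inversion set.

    If each cover lies in a root-triple as required and [D] is properly
    contained in a Condorcet domain [E], pick [w] in [E] outside [D].  Its
    inversion set is not an ideal, so it contains [b] and not [a] for some
    cover [a], [b].  Applying [condorcetP] to [E] and to the opposite of the
    triple [a, - b, c] leaves [c <= b] or [c <= - a] in [D], both excluded by
    the previous paragraph.

    Conversely, let [p], [q] be a cover that lies in no root-triple in this
    sense.  Removing from [<=] the two pairs [(p, q)] and [(- q, - p)] keeps a
    partial order that still has a pair in each root-triple.  Choose an ideal
    of it that contains [q] and [- p] and exactly one of [a], [- a] for each
    root [a] (definition [completion]).  It is the inversion set of some [w],
    which is outside [D] and can be added to [D]. *)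

Set Implicit Arguments.
Unset Strict Implicit.
Unset Printing Implicit Defensive.

Local Open Scope fset_scope.
Local Open Scope ring_scope.

(** * Reflections *)

Section DotProduct.
Context {R : realType} {n : nat}.
Implicit Types (u v w a b : 'cV[R]_n) (c : R).

Lemma dotp_mx u v : u^T *m v = (dotp u v)%:M.
Proof.
apply/matrixP=> i j; rewrite !ord1 !mxE eqxx mulr1n.
by apply: eq_bigr => k _; rewrite mxE.
Qed.

Lemma dotpDr u v w : dotp u (v + w) = dotp u v + dotp u w.
Proof. by rewrite -big_split; apply: eq_bigr => i _; rewrite mxE mulrDr. Qed.

Lemma dotpZr c u v : dotp u (c *: v) = c * dotp u v.
Proof. by rewrite mulr_sumr; apply: eq_bigr => i _; rewrite mxE mulrCA. Qed.

Lemma dotp0r u : dotp u 0 = 0.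
Proof. by rewrite -(scale0r 0) dotpZr mul0r. Qed.

Lemma dotpNr u v : dotp u (- v) = - dotp u v.
Proof. by rewrite -scaleN1r dotpZr mulN1r. Qed.

Lemma dotpC u v : dotp u v = dotp v u.
Proof. by apply: eq_bigr => i _; rewrite mulrC. Qed.

Lemma dotp_gt0 u : u != 0 -> 0 < dotp u u.
Proof.
have u2_ge0 i : 0 <= u i 0 * u i 0 by rewrite -expr2 sqr_ge0.
move=> u_neq0; rewrite lt_neqAle sumr_ge0 ?andbT //.
apply: contra_neq u_neq0 => /esym/psumr_eq0P u2_eq0; apply/matrixP=> i j.
rewrite ord1 mxE; apply/eqP; rewrite -(orbb (_ == 0)) -mulf_eq0.
by apply/eqP/u2_eq0.
Qed.

Lemma refl_mul a b : refl a *m b = b - (2 / dotp a a * dotp a b) *: a.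
Proof.
by rewrite /refl mulmxBl mul1mx -scalemxAl -mulmxA dotp_mx mul_mx_scalar scalerA.
Qed.

Lemma refl_self a : a != 0 -> refl a *m a = - a.
Proof.
move=> /dotp_gt0 aa; rewrite refl_mul divfK ?gt_eqF // scaler_nat mulr2n.
by rewrite opprD addrA subrr sub0r.
Qed.

Lemma reflK a b : a != 0 -> refl a *m (refl a *m b) = b.
Proof.
move=> a_neq0; rewrite [in LHS](refl_mul a b) mulmxBr -scalemxAr refl_self //.
by rewrite refl_mul scalerN opprK subrK.
Qed.

Lemma refl_invol a : a != 0 -> refl a *m refl a = 1%:M.
Proof.
move=> a_neq0; apply/trmx_inj/row_matrixP => i; apply/trmx_inj.
by rewrite !tr_row !trmxK !colE -mulmxA reflK // mul1mx.
Qed.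

Lemma refl_unit a : a != 0 -> refl a \in unitmx.
Proof. by move=> /refl_invol/mulmx1_unit[]. Qed.

Lemma invmx_refl a : a != 0 -> invmx (refl a) = refl a.
Proof.
move=> a_neq0; rewrite -[RHS](mulKmx (refl_unit a_neq0)).
by rewrite refl_invol // mulmx1.
Qed.

Lemma invmx_mul (A B : 'M[R]_n) : A \in unitmx -> B \in unitmx ->
  invmx (A *m B) = invmx B *m invmx A.
Proof.
move=> AU BU; have ABU : A *m B \in unitmx by rewrite unitmx_mul AU.
rewrite -[LHS]mul1mx -(mulVmx BU) -[X in _ *m X *m _](mulKmx AU).
by rewrite -!mulmxA (mulmxA A B) mulmxV // mulmx1.
Qed.

End DotProduct.

(** * Finitely generated cones *)

Section Cone.
Context {R : realType} {n : nat}.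
Implicit Types (S T : {fset 'cV[R]_n}) (u v x a : 'cV[R]_n) (c : R).

Inductive cone S : 'cV[R]_n -> Prop :=
| cone_zero : cone S 0
| cone_step c x v : 0 <= c -> x \in S -> cone S v -> cone S (c *: x + v).

Lemma cone_mem S x : x \in S -> cone S x.
Proof.
by move=> xS; rewrite -[x]addr0 -[x]scale1r; apply: cone_step (cone_zero S).
Qed.

Lemma cone_add S u v : cone S u -> cone S v -> cone S (u + v).
Proof.
move=> + Sv; elim=> [|c x w c_ge0 xS _ IH]; first by rewrite add0r.
by rewrite -addrA; apply: cone_step.
Qed.

Lemma cone_scale S c v : 0 <= c -> cone S v -> cone S (c *: v).
Proof.
move=> c_ge0; elim=> [|d x w d_ge0 xS _ IH]; first by rewrite scaler0; left.
by rewrite scalerDr scalerA; apply: cone_step => //; apply: mulr_ge0.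
Qed.

Lemma cone_trans S T v :
  (forall x, x \in S -> cone T x) -> cone S v -> cone T v.
Proof.
move=> ST; elim=> [|c x w c_ge0 /ST xT _ IH]; first by left.
by apply: cone_add => //; apply: cone_scale.
Qed.

(** This isolates the part of [v] along [a], so that two expressions of [v] can
    be compared without a basis. *)
Lemma cone_split S a v : cone S v ->
  exists c u, [/\ 0 <= c, cone (S `\ a) u & v = c *: a + u].
Proof.
elim=> [|c x w c_ge0 xS _ [d [u [d_ge0 Su ->]]]].
  by exists 0, 0; rewrite scale0r addr0; split=> //; left.
case: (eqVneq x a) => [->|xa].
  by exists (c + d), u; rewrite scalerDl addrA addr_ge0.
exists d, (c *: x + u); split=> //; last by rewrite addrCA.
by apply: cone_step => //; rewrite !inE xa.
Qed.

Lemma cone_dotp_le0 S u v : (forall x, x \in S -> dotp u x <= 0) ->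
  cone S v -> dotp u v <= 0.
Proof.
move=> uS; elim=> [|c x w c_ge0 /uS ux _ IH]; first by rewrite dotp0r.
by rewrite dotpDr dotpZr; nra.
Qed.

Lemma cone_pointed S l v : (forall x, x \in S -> 0 < dotp l x) ->
  cone S v -> dotp l v <= 0 -> v = 0.
Proof.
move=> lS Sv lv.
suff [//|] : v = 0 \/ 0 < dotp l v by rewrite ltNge lv.
elim: Sv {lv} => [|c x w c_ge0 /lS lx _ IH]; first by left.
move: c_ge0; rewrite le_eqVlt => /predU1P[<-|c_gt0].
  by rewrite scale0r add0r.
by right; rewrite dotpDr dotpZr; case: IH => [->|?]; rewrite ?dotp0r; nra.
Qed.

(** Discarding redundant generators one at a time ends at an irredundant set. *)
Lemma cone_min_generators S : exists T, [/\ T `<=` S,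
  forall x, x \in S -> cone T x & forall x, x \in T -> ~ cone (T `\ x) x].
Proof.
have [k] := ubnP #|` S|; elim: k S => // k IH S; rewrite ltnS => Sk.
have [[x xS xcone]|indep] := pselect (exists2 x, x \in S & cone (S `\ x) x).
  have [|T [TS ST Tmin]] := IH (S `\ x); first by move: Sk; rewrite (cardfsD1 x S) xS.
  exists T; split=> // [|y yS].
    by apply: fsubset_trans TS _; apply: fsubsetDl.
  apply: cone_trans ST _; have [->//|yx] := eqVneq y x.
  by apply: cone_mem; rewrite !inE yx.
exists S; split=> // x; first exact: cone_mem.
by move=> xS xcone; apply: indep; exists x.
Qed.

End Cone.

(** * Roots and inversion sets *)

Section RootSystem.
Context {R : realType} {n : nat}.
Variables (Phi Phip : {fset 'cV[R]_n}) (l : 'cV[R]_n).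
Hypothesis Phi_root : root_system Phi.
Hypothesis l_generic : forall a, a \in Phi -> dotp l a != 0.
Hypothesis PhipE : Phip = [fset a in Phi | 0 < dotp l a].
Implicit Types (a b c : 'cV[R]_n) (J : {fset 'cV[R]_n}) (w : 'M[R]_n).

Local Notation N := (inv_set Phi Phip).

Lemma root_neq0 a : a \in Phi -> a != 0.
Proof. by case: Phi_root => + _ _; apply. Qed.

Lemma root_opp a : a \in Phi -> - a \in Phi.
Proof.
move=> aP; case: Phi_root => _ /(_ a aP (- a)) [_ opp] _.
by case: opp => //; right.
Qed.

Lemma root_oppE a : ((- a : 'cV[R]_n) \in Phi) = (a \in Phi).
Proof. by apply/idP/idP => /root_opp; rewrite ?opprK. Qed.

Lemma root_scale a k : a \in Phi -> k *: a \in Phi -> k *: a = a \/ k *: a = - a.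
Proof.
move=> aP kaP; case: Phi_root => _ /(_ a aP (k *: a)) [opp _] _.
by apply: opp; split=> //; exists k.
Qed.

Lemma root_refl a b : a \in Phi -> b \in Phi -> refl a *m b \in Phi.
Proof.
move=> aP bP; case: Phi_root => _ _ /(_ a aP) <-.
by apply/imfsetP; exists b.
Qed.

Lemma mem_pos a : (a \in Phip) = (a \in Phi) && (0 < dotp l a).
Proof. by rewrite PhipE !inE. Qed.

Lemma pos_root a : a \in Phip -> a \in Phi.
Proof. by rewrite mem_pos => /andP[]. Qed.

Lemma mem_neg a : a \in Phi -> (a \notin Phip) = (dotp l a < 0).
Proof.
by move=> aP; rewrite mem_pos aP -leNgt le_eqVlt (negPf (l_generic aP)).
Qed.

Lemma mem_pos_opp a : a \in Phi ->
  ((- a : 'cV[R]_n) \in Phip) = (a \notin Phip).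
Proof.
by move=> aP; rewrite mem_pos root_oppE aP mem_neg // dotpNr oppr_gt0.
Qed.

Lemma coxeter_unit_stable w : coxeter_group Phi w ->
  w \in unitmx /\
  forall a, a \in Phi -> w *m a \in Phi /\ invmx w *m a \in Phi.
Proof.
elim=> [|a aP|u v _ [uU uP] _ [vU vP]|u _ [uU uP]].
- by rewrite unitmx1; split=> // a aP; rewrite invmx1 mul1mx.
- have a0 := root_neq0 aP; rewrite refl_unit //; split=> // b bP.
  by rewrite invmx_refl // root_refl.
- rewrite unitmx_mul uU vU; split=> // a aP; rewrite invmx_mul // -!mulmxA.
  by split; [apply uP; apply vP | apply vP; apply uP].
- by rewrite unitmx_inv invmxK; split=> // a /uP[].
Qed.

Lemma mem_inv_set w a : coxeter_group Phi w ->
  (a \in N w) = (a \in Phi) && (dotp l (invmx w *m a) < 0).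
Proof.
move=> /coxeter_unit_stable[_ wP]; rewrite !inE /=.
case aP: (a \in Phi) => //=; have [_ waP] := wP a aP.
by rewrite waP andbT mem_neg.
Qed.

Lemma triple_opp a b c : root_triple Phi a b c ->
  root_triple Phi (- a) (- b) (- c).
Proof.
case=> /and3P[aP bP cP] abc [x [y [z [x0 y0 z0 e]]]]; split.
- by rewrite !root_oppE aP bP cP.
- rewrite -[X in uniq X]/(map -%R [:: a; b; c]) map_inj_uniq //.
  exact: oppr_inj.
- by exists x, y, z; split=> //; rewrite !scalerN -!opprD e oppr0.
Qed.

Lemma triple_roots a b c : root_triple Phi a b c ->
  [/\ a \in Phi, b \in Phi & c \in Phi].
Proof. by case=> /and3P. Qed.

Lemma triple_rot a b c : root_triple Phi a b c -> root_triple Phi b c a.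
Proof.
case=> /and3P[aP bP cP] abc [x [y [z [x0 y0 z0 e]]]]; split.
- by rewrite bP cP aP.
- by rewrite -[X in uniq X]/(rot 1 [:: a; b; c]) rot_uniq.
- by exists y, z, x; split=> //; rewrite addrC addrA.
Qed.

Lemma triple_swap a b c : root_triple Phi a b c -> root_triple Phi b a c.
Proof.
case=> /and3P[aP bP cP] abc [x [y [z [x0 y0 z0 e]]]]; split.
- by rewrite bP cP aP.
- move: abc; rewrite /= !inE !negb_or (eq_sym b a).
  by case: (a == b); case: (a == c); case: (b == c).
- by exists y, x, z; split=> //; rewrite (addrC (y *: b)).
Qed.

(** Three positively dependent roots of which two are opposite would all be
    proportional, and a line contains only two roots. *)
Lemma triple_neq_opp a b c : root_triple Phi a b c -> a != - b.
Proof.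
case=> /and3P[aP bP cP] abc [x [y [z [x0 y0 z0 e]]]].
apply: contraTneq abc => ab; move: e; rewrite ab scalerN => e.
have cE : c = ((x - y) / z) *: b.
  have zc : z *: c = (x - y) *: b.
    apply: (@addrI _ (- (x *: b) + y *: b)).
    by rewrite e scalerBl addrACA addNr subrr addr0.
  by rewrite mulrC -scalerA -zc scalerA mulVf ?scale1r // gt_eqF.
have [||cb|cb] := @root_scale b ((x - y) / z); rewrite -?cE //.
  by rewrite cE cb /= !inE eqxx andbF.
by rewrite cE cb /= !inE eqxx orbT.
Qed.

Lemma triple_third x y z p q : root_triple Phi x y z ->
  p \in [:: x; y; z] -> q \in [:: x; y; z] -> p != q ->
  exists c, root_triple Phi p q c.
Proof.
move=> xyz; have yzx := triple_rot xyz; have zxy := triple_rot yzx.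
by rewrite !inE => /or3P[]/eqP-> /or3P[]/eqP->; rewrite ?eqxx // => _; eexists;
  first [eassumption | apply: triple_swap; eassumption].
Qed.

Definition half_system J : Prop :=
  J `<=` Phi /\ forall a, a \in Phi -> ((- a : 'cV[R]_n) \in J) = (a \notin J).

Definition triple_free J : Prop :=
  forall a b c, root_triple Phi a b c -> ~~ [&& a \in J, b \in J & c \in J].

Lemma inv_set_half w : coxeter_group Phi w -> half_system (N w).
Proof.
move=> wW; split=> [|a aP]; first by apply/fsubsetP=> a; rewrite !inE => /andP[].
rewrite !mem_inv_set // root_oppE aP mulmxN dotpNr oppr_lt0 -leNgt /=.
have [_ /(_ a aP)[_ waP]] := coxeter_unit_stable wW.
by rewrite le_eqVlt eq_sym (negPf (l_generic waP)).
Qed.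

Lemma inv_set_triple_free w : coxeter_group Phi w -> triple_free (N w).
Proof.
move=> wW a b c [_ _ [x [y [z [x0 y0 z0 e]]]]].
rewrite !mem_inv_set //; apply/negP=> /and3P[/andP[_ a0] /andP[_ b0] /andP[_ c0]].
have := dotp0r l; rewrite -(mulmx0 _ (invmx w)) -e !mulmxDr -!scalemxAr.
by rewrite !dotpDr !dotpZr; nra.
Qed.

(** The simple roots are the irredundant generators of the cone spanned by the
    positive roots.  If the reflection in such an [a] sent another positive
    root to a negative one, adding up the two expressions would put a multiple
    of [a] in the cone of the other generators.  The last clause holds because
    [b] has positive product with itself, hence with some generator. *)
Lemma simple_roots : exists T : {fset 'cV[R]_n}, [/\ T `<=` Phip,
  forall a b, a \in T -> b \in Phip -> b != a -> refl a *m b \in Phip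
  & forall b, b \in Phip -> exists2 a, a \in T & 0 < dotp a b].
Proof.
have [T [/fsubsetP TP PT Tmin]] := cone_min_generators Phip.
have pos_gt0 a : a \in Phip -> 0 < dotp l a by rewrite mem_pos => /andP[].
exists T; split; first exact/fsubsetP.
- move=> a b aT bP ba; apply: contraT => sbN.
  have aP := TP a aT; have aPhi := pos_root aP; have bPhi := pos_root bP.
  have [c [u [c0 Tu bE]]] := cone_split a (PT b bP).
  have /PT/(cone_split a) [d [v [d0 Tv sbE]]] : - (refl a *m b) \in Phip.
    by rewrite mem_pos_opp ?root_refl.
  have Tuv := cone_add Tu Tv.
  set k := 2 / dotp a a * dotp a b.
  (* Here [b = c a + u] and [- (b - k a) = d a + v], where [u] and [v] avoid [a]. *)
  have uvE : u + v = (k - c - d) *: a.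
    apply: (@addrI _ (c *: a + d *: a)); rewrite addrACA -bE -sbE refl_mul -/k.
    by rewrite opprB addrC subrK -!scalerDl; congr (_ *: _); ring.
  have T'l x : x \in T `\ a -> 0 < dotp l x.
    by rewrite !inE => /andP[_ /TP/pos_gt0].
  have [k_gt|k_le] := ltP 0 (k - c - d).
    case: (Tmin a aT).
    have := cone_scale (ltW (etrans (invr_gt0 _) k_gt)) Tuv.
    by rewrite uvE scalerA mulVf ?gt_eqF // scale1r.
  have uv0 : u + v = 0.
    apply: (cone_pointed T'l Tuv); rewrite uvE dotpZr.
    by have := pos_gt0 _ aP; nra.
  have u0 : u = 0.
    apply: (cone_pointed T'l Tu); rewrite leNgt; apply/negP=> lu.
    have v0 : v = 0.
      apply: (cone_pointed T'l Tv).
      have := dotp0r l; rewrite -uv0 dotpDr; lra.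
    by move: lu; rewrite -[u]addr0 -v0 uv0 dotp0r ltxx.
  move: bE; rewrite u0 addr0 => bE.
  have [||bEa|bEa] := @root_scale a c; rewrite -?bE //.
    by rewrite -bE in bEa; rewrite bEa eqxx in ba.
  rewrite -bE in bEa; have := pos_gt0 b bP; have := pos_gt0 a aP.
  by rewrite bEa dotpNr; lra.
- move=> b bP; have [[a aT ab]|H] := pselect (exists2 a, a \in T & 0 < dotp a b).
    by exists a.
  have bb := dotp_gt0 (root_neq0 (pos_root bP)).
  suff : dotp b b <= 0 by rewrite leNgt bb.
  apply: cone_dotp_le0 (PT b bP) => a aT; rewrite leNgt dotpC; apply/negP=> ab.
  by apply: H; exists a.
Qed.

Lemma half_mem_triple J a b c :
  half_system J -> triple_free J -> root_triple Phi a b c ->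
  a \in J -> b \in J -> - c \in J.
Proof.
move=> [_ Jopp] Jfree abc aJ bJ; have [_ _ cP] := triple_roots abc.
by rewrite Jopp //; have := Jfree _ _ _ abc; rewrite aJ bJ.
Qed.

(** Induction on height: for [b] positive and not simple, [s = b - k a] with [a]
    simple and [k > 0] is a lower positive root, and [- a, b, - s] is a
    root-triple.  If [b] were in [J], then so would be [s], since [- a] is. *)
Lemma half_disjoint_pos J (T : {fset 'cV[R]_n}) :
  half_system J -> triple_free J -> T `<=` Phip ->
  (forall b, b \in Phip -> exists2 a, a \in T & 0 < dotp a b) ->
  (forall a b, a \in T -> b \in Phip -> b != a -> refl a *m b \in Phip) ->
  (forall a, a \in T -> a \notin J) -> forall b, b \in Phip -> b \notin J.
Proof.
move=> Jhalf Jfree /fsubsetP TP Tpos Trefl TJ b.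
have [k] := ubnP #|` [fset x in Phip | dotp l x < dotp l b]|.
elim: k b => // k IH b; rewrite ltnS => bk bP.
have [a aT ab] := Tpos b bP; have aP := TP a aT.
have [->|ba] := eqVneq b a; first exact: TJ.
have aPhi := pos_root aP; have bPhi := pos_root bP.
have sP := Trefl a b aT bP ba; have sPhi := pos_root sP.
have la : 0 < dotp l a by move: aP; rewrite mem_pos => /andP[].
set s := refl a *m b in sP sPhi *.
set k' := 2 / dotp a a * dotp a b.
have k'_gt0 : 0 < k' by rewrite !mulr_gt0 // invr_gt0 dotp_gt0 // root_neq0.
have sE : s = b - k' *: a by rewrite /s refl_mul.
have ls : dotp l s < dotp l b by rewrite sE dotpDr dotpNr dotpZr; nra.
have sJ : s \notin J.
  apply: IH => //; apply: leq_trans bk.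
  rewrite [X in (_ < X)%N](cardfsD1 s) !inE /= sP ls ltnS.
  apply/fsubset_leq_card/fsubsetP => x; rewrite !inE /= => /andP[-> xs] /=.
  by rewrite (lt_trans xs ls) andbT; apply: contraTneq xs => ->; rewrite ltxx.
apply: contra sJ => bJ; rewrite -[s]opprK.
apply: (half_mem_triple (a := - a) (b := b)) => //; last first.
  by case: Jhalf => _ ->; rewrite ?TJ.
split; first by rewrite !root_oppE aPhi bPhi.
- rewrite /= !inE !negb_or andbT eqr_opp -andbA; apply/and3P; split.
  + by apply: contraTneq bP => <-; rewrite mem_pos_opp // aP.
  + apply: contraTneq bP => as_; rewrite -(reflK b (root_neq0 aPhi)) -/s -as_.
    by rewrite refl_self ?root_neq0 // mem_pos_opp // aP.
  + by apply: contraTneq bP => ->; rewrite mem_pos_opp // sP.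
- exists k', 1, 1; split=> //; rewrite sE !scale1r scalerN.
  by rewrite [- _ + b]addrC subrr.
Qed.

Lemma refl_triple s a b c : s \in Phi -> root_triple Phi a b c ->
  root_triple Phi (refl s *m a) (refl s *m b) (refl s *m c).
Proof.
move=> sP [/and3P[aP bP cP] abc [x [y [z [x0 y0 z0 e]]]]]; split.
- by rewrite !root_refl.
- rewrite -[X in uniq X]/(map (mulmx (refl s)) [:: a; b; c]) map_inj_uniq //.
  by apply: (can_inj (g := mulmx (refl s))) => v; rewrite reflK ?root_neq0.
- by exists x, y, z; split=> //; rewrite !scalemxAr -!mulmxDr e mulmx0.
Qed.

(** A simple reflection permutes the positive roots other than its own root.
    So if [J] contains the simple root [s], its image under the reflection in
    [s] has one positive root less, and induction applies. *)
Lemma half_triple_free_inv_set J : half_system J -> triple_free J ->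
  exists2 w, coxeter_group Phi w & N w = J.
Proof.
have [T [/fsubsetP TP Trefl Tpos]] := simple_roots.
have [k] := ubnP #|` J `&` Phip|.
elim: k J => // k IH J; rewrite ltnS => Jk Jhalf Jfree.
have [/fsubsetP JPhi Jopp] := Jhalf.
have [[s sT sJ]|noT] := pselect (exists2 s, s \in T & s \in J); last first.
  have posNJ b : b \in Phip -> b \notin J.
    apply: half_disjoint_pos Jhalf Jfree _ Tpos Trefl _ b; first exact/fsubsetP.
    by move=> a aT; apply/negP=> aJ; apply: noT; exists a.
  exists 1%:M; first exact: cox_one.
  apply/fsetP=> a; rewrite !inE /= invmx1 mul1mx.
  case aP: (a \in Phi) => /=; last first.
    by apply/esym; apply: contraFF aP; apply: JPhi.
  rewrite andbT; apply/idP/idP=> [aN|]; last exact/contraL/posNJ.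
  apply: contraNT aN => aJ; move: (posNJ (- a)).
  by rewrite mem_pos_opp // Jopp // aJ; case: (a \in Phip) => //= /(_ isT).
have sPos := TP s sT; have sPhi := pos_root sPos; have s0 := root_neq0 sPhi.
set J' := [fset x in Phi | refl s *m x \in J].
have memJ' x : x \in Phi -> (x \in J') = (refl s *m x \in J).
  by move=> xP; rewrite !inE /= xP.
have [|||w wW wJ'] := IH J'.
- apply: leq_trans Jk; rewrite [X in (_ < X)%N](cardfsD1 s) !inE sJ sPos /= ltnS.
  have <- : #|` [fset refl s *m x | x in J' `&` Phip]| = #|` J' `&` Phip|.
    by apply: card_imfset; apply: can_inj (fun x => reflK x s0).
  apply/fsubset_leq_card/fsubsetP => _ /imfsetP[x /= + ->].
  rewrite !inE /= => /andP[/andP[xP sxJ] xPos].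
  have xs : x != s.
    by apply: contraTneq sxJ => ->; rewrite refl_self // Jopp // sJ.
  rewrite sxJ (Trefl s) // !andbT; apply: contraTneq xPos => sx.
  by rewrite -(reflK x s0) sx refl_self // mem_pos_opp // sPos.
- split=> [|a aP]; first by apply/fsubsetP=> x; rewrite !inE => /andP[].
  by rewrite !memJ' ?root_opp // mulmxN Jopp ?root_refl.
- move=> a b c abc; have [aP bP cP] := triple_roots abc.
  by rewrite !memJ' //; apply/Jfree/refl_triple.
exists (refl s *m w); first by apply: cox_mul => //; apply: cox_refl.
have [wU _] := coxeter_unit_stable wW.
apply/fsetP=> a; rewrite mem_inv_set; last by apply: cox_mul => //; apply: cox_refl.
case aP: (a \in Phi) => /=; last first.
  by apply/esym; apply: contraFF aP; apply: JPhi.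
have saP : refl s *m a \in Phi by apply: root_refl.
rewrite invmx_mul ?refl_unit // -mulmxA invmx_refl //.
rewrite -[a in RHS](reflK a s0) -memJ' // -wJ' mem_inv_set // saP //.
Qed.

End RootSystem.

(** * The preposet of a Condorcet domain *)

Section Domains.
Context {R : realType} {n : nat}.
Variables (Phi Phip : {fset 'cV[R]_n}).
Hypothesis Phi_root : root_system Phi.
Hypothesis Phip_pos : positive_system Phi Phip.
Implicit Types (a b c : 'cV[R]_n) (J : {fset 'cV[R]_n}).
Implicit Types (u v w x : 'M[R]_n) (D E : {fset 'M[R]_n}).

Local Notation N := (inv_set Phi Phip).
Local Notation "a <=[ D ] b" := (phi_le Phi Phip D a b) (at level 70).

Lemma inv_setN w a : coxeter_group Phi w -> a \in Phi ->
  ((- a : 'cV[R]_n) \in N w) = (a \notin N w).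
Proof.
by have [l [l0 PE]] := Phip_pos => /(inv_set_half Phi_root l0 PE)[_]; apply.
Qed.

Lemma inv_set_root w a : a \in N w -> a \in Phi.
Proof. by rewrite !inE => /andP[]. Qed.

Lemma inv_set_no_triple w a b c : coxeter_group Phi w -> root_triple Phi a b c ->
  a \in N w -> b \in N w -> c \notin N w.
Proof.
have [l [l0 PE]] := Phip_pos => /(inv_set_triple_free Phi_root l0 PE) + abc aN bN.
by move=> /(_ _ _ _ abc); rewrite aN bN.
Qed.

Lemma half_inv_set J : half_system Phi J -> triple_free Phi J ->
  exists2 w, coxeter_group Phi w & N w = J.
Proof.
by have [l [l0 PE]] := Phip_pos; apply: half_triple_free_inv_set PE _.
Qed.

Lemma mem_dom_at D a v : (v \in dom_at Phi Phip D a) = (v \in D) && (a \in N v).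
Proof. by rewrite !inE. Qed.

Lemma phi_leP D a b :
  reflect (forall v, v \in D -> b \in N v -> a \in N v) (a <=[D] b).
Proof.
apply: (iffP idP) => [/fsubsetP ab v vD bv|ab].
  by have := ab v; rewrite !mem_dom_at vD => /(_ bv).
apply/fsubsetP=> v; rewrite !mem_dom_at => /andP[vD bv].
by rewrite vD; apply: ab.
Qed.

Lemma phi_le_refl D a : a <=[D] a.
Proof. exact: fsubset_refl. Qed.

Lemma phi_le_trans D b a c : a <=[D] b -> b <=[D] c -> a <=[D] c.
Proof. by move=> ab bc; apply: fsubset_trans bc ab. Qed.

Lemma phi_le_sub D E a b : D `<=` E -> a <=[E] b -> a <=[D] b.
Proof. by move=> /fsubsetP DE /phi_leP ab; apply/phi_leP=> v /DE; apply: ab. Qed.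

Section Group.
Variable D : {fset 'M[R]_n}.
Hypothesis DW : forall w, w \in D -> coxeter_group Phi w.

Lemma phi_le_opp a b : a \in Phi -> b \in Phi ->
  a <=[D] b -> (- b) <=[D] (- a).
Proof.
move=> aP bP /phi_leP ab; apply/phi_leP=> v vD.
rewrite !(inv_setN (DW vD)) //; apply: contra; exact: ab.
Qed.

Lemma phi_le_oppl a b : a \in Phi ->
  reflect (forall v, v \in D -> ~~ ((a \in N v) && (b \in N v))) ((- a) <=[D] b).
Proof.
move=> aP; apply: (iffP (phi_leP _ _ _)) => ab v vD.
  apply/negP=> /andP[av bv]; have := ab v vD bv.
  by rewrite (inv_setN (DW vD)) // av.
by move=> bv; rewrite (inv_setN (DW vD)) //; have := ab v vD; rewrite bv andbT.
Qed.

End Group.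

(** Condorcet domains become a condition on [phi_le] alone: the forbidden pattern
    fails on a root-triple as soon as two of its roots are never inverted
    together.  The three members in the pattern are automatically distinct, as
    no inversion set contains a root-triple. *)
Lemma condorcetP D : condorcet Phi Phip D <->
  [/\ D != fset0, forall w, w \in D -> coxeter_group Phi w
    & forall a b c, root_triple Phi a b c ->
      [|| (- a) <=[D] b, (- a) <=[D] c | (- b) <=[D] c]].
Proof.
split=> -[D0 DW cond]; split=> //.
- move=> a b c abc; have [aP bP cP] := triple_roots abc.
  apply: contra_notT cond; rewrite !negb_or => /and3P[ab ac bc].
  have witness p q : p \in Phi -> ~~ ((- p) <=[D] q) ->
      exists2 v, v \in D & (p \in N v) && (q \in N v).
    move=> pP pq; apply: contrapT => none; case/negP: pq.
    apply/(phi_le_oppl DW) => // v vD; apply/negP=> pqv.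
    by apply: none; exists v.
  have [u uD /andP[au bu]] := witness _ _ aP ab.
  have [v vD /andP[av cv]] := witness _ _ aP ac.
  have [w wD /andP[bw cw]] := witness _ _ bP bc.
  exists u, v, w, a, b, c; split=> //; first by rewrite uD vD wD.
  have cu := inv_set_no_triple (DW u uD) abc au bu.
  have aw : a \notin N w.
    by apply: (inv_set_no_triple (DW w wD) (triple_rot abc)).
  rewrite /= !inE !negb_or andbT -andbA; apply/and3P; split.
  + by apply: contraNneq cu => ->.
  + by apply: contraNneq cu => ->.
  + by apply: contraNneq aw => <-.
- case=> u [v [w [a [b [c [/and3P[uD vD wD] _ abc]]]]]].
  case=> -[au bu] [av cv] [bw cw]; have [aP bP cP] := triple_roots abc.
  case/or3P: (cond _ _ _ abc) => /(phi_le_oppl DW) pq.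
  + by have := pq aP u uD; rewrite au bu.
  + by have := pq aP v vD; rewrite av cv.
  + by have := pq bP w wD; rewrite bw cw.
Qed.

Definition majority (p q r : bool) : bool := [|| p && q, p && r | q && r].

(** One vote for each of [u], [v], [w] gives three votes in all, hence no tie;
    repetitions among the three are allowed. *)
Lemma nu_majority D u v w x : u \in D -> v \in D -> w \in D ->
  coxeter_group Phi x ->
  (forall a, a \in N x -> majority (a \in N u) (a \in N v) (a \in N w)) ->
  nu Phi Phip D x.
Proof.
move=> uD vD wD xW xmaj.
pose f y : nat := ((y == u) + (y == v) + (y == w))%N.
have sum1 (P : pred 'M[R]_n) y : y \in D ->
    (\sum_(z <- D | P z) (z == y) = P y)%N.
  move=> yD; rewrite big_mkcond (bigD1_seq y) //= eqxx big1 ?addn0.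
    by case: (P y).
  by move=> z /negPf->; rewrite if_same.
have votesE a : votes_for Phi Phip D f a =
    ((a \in N u) + (a \in N v) + (a \in N w))%N.
  by rewrite /votes_for !big_split /= !sum1.
have totalE : total_votes D f = 3.
  by rewrite /total_votes !big_split /= !(sum1 xpredT).
exists f; split.
- by exists u; rewrite // /f eqxx.
- move=> a aP; rewrite votesE totalE; set k := (_ + _)%N.
  apply/eqP => /(congr1 ( *%R^~ 2)); rewrite divfK // -natrM => /eqP.
  by rewrite eqr_nat => /eqP; lia.
- split=> //; apply/fsubsetP=> a ax; rewrite !inE /= (inv_set_root ax) /=.
  rewrite votesE totalE ler_pdivrMr // -natrM ler_nat.
  by move: (xmaj a ax); case: (a \in N u); case: (a \in N v); case: (a \in N w).
Qed.

(** * Closed domains *)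

Section Closed.
Variable D : {fset 'M[R]_n}.
Hypothesis D_condorcet : condorcet Phi Phip D.
Hypothesis D_closed : closed_domain Phi Phip D.

Let DW w : w \in D -> coxeter_group Phi w.
Proof. by case: D_condorcet => _ + _; apply. Qed.

(** If two roots of a triple are never inverted together by members of [D], a
    majority of three members does not invert them together either. *)
Lemma closed_majority u v w : u \in D -> v \in D -> w \in D ->
  exists2 x, x \in D & forall a, a \in Phi ->
    (a \in N x) = majority (a \in N u) (a \in N v) (a \in N w).
Proof.
move=> uD vD wD.
pose J := [fset a in Phi | majority (a \in N u) (a \in N v) (a \in N w)].
have memJ (a : 'cV[R]_n) : a \in Phi ->
    (a \in J) = majority (a \in N u) (a \in N v) (a \in N w).
  by move=> aP; rewrite !inE /= aP.
have Jhalf : half_system Phi J.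
  split=> [|a aP]; first by apply/fsubsetP=> a; rewrite !inE => /andP[].
  have naP := root_opp Phi_root aP.
  rewrite !memJ // (inv_setN (DW uD)) // (inv_setN (DW vD)) //.
  rewrite (inv_setN (DW wD)) //.
  by case: (a \in N u); case: (a \in N v); case: (a \in N w).
have Jpair a b : a \in Phi -> b \in Phi -> (- a) <=[D] b ->
    ~~ ((a \in J) && (b \in J)).
  move=> aP bP /(phi_le_oppl DW) => /(_ aP) ab; rewrite !memJ //.
  move: (ab u uD) (ab v vD) (ab w wD).
  case: (a \in N u); case: (a \in N v); case: (a \in N w);
    by case: (b \in N u); case: (b \in N v); case: (b \in N w).
have Jfree : triple_free Phi J.
  move=> a b c abc; have [aP bP cP] := triple_roots abc.
  have [_ _ /(_ _ _ _ abc)] := (condorcetP D).1 D_condorcet.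
  by case/or3P=> /Jpair; [move/(_ aP bP) | move/(_ aP cP) | move/(_ bP cP)];
    case: (a \in J); case: (b \in J); case: (c \in J).
have [x xW xJ] := half_inv_set Jhalf Jfree.
exists x; last by move=> a /memJ; rewrite xJ.
apply/D_closed/(nu_majority uD vD wD xW) => a ax.
by rewrite -memJ -?xJ // (inv_set_root ax).
Qed.

(** The Baker-Pixley argument.  Being an ideal means that any two roots of [N w]
    are inverted together by some member of [D]; majorities of three members
    extend this from two roots to any finite number. *)
Lemma closed_ideal w : coxeter_group Phi w ->
  (forall a b, a \in Phi -> b \in Phi -> a <=[D] b -> b \in N w -> a \in N w) ->
  w \in D.
Proof.
move=> wW w_ideal.
have pair a b : a \in N w -> b \in N w ->
    exists2 v, v \in D & (a \in N v) && (b \in N v).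
  move=> aw bw; have aP := inv_set_root aw; have bP := inv_set_root bw.
  apply: contrapT => none.
  have /w_ideal : (- a) <=[D] b.
    apply/(phi_le_oppl DW) => // v vD; apply/negP=> abv.
    by apply: none; exists v.
  by move=> /(_ (root_opp Phi_root aP) bP bw); rewrite (inv_setN wW) // aw.
have agree (s : seq 'cV[R]_n) : {subset s <= N w} ->
    exists2 v, v \in D & {subset s <= N v}.
  have [k] := ubnP (size s); elim: k s => // k IH [|a [|b [|c s]]] /=.
  - move=> _ _; have [D0 _ _] := D_condorcet.
    by have /fset0Pn[v vD] := D0; exists v.
  - move=> _ sw; have aw : a \in N w by rewrite sw ?mem_head.
    have [v vD /andP[av _]] := pair a a aw aw.
    by exists v => // e; rewrite inE => /eqP->.
  - move=> _ sw; have aw : a \in N w by rewrite sw ?mem_head.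
    have bw : b \in N w by rewrite sw // !(mem_head, in_cons) orbT.
    have [v vD /andP[av bv]] := pair a b aw bw.
    by exists v => // e; rewrite in_cons mem_seq1 => /orP[]/eqP->.
  - rewrite ltnS => sk sw.
    have sub t : size t = (size s).+2 -> {subset t <= [:: a, b, c & s]} ->
        exists2 v, v \in D & {subset t <= N v}.
      by move=> tk ts; apply: IH => [|e /ts /sw //]; rewrite tk.
    (* Each root of the list is in at least two of the three sublists that omit
       one of [a], [b], [c], so a majority inverts it. *)
    have [|v1 v1D s1] := sub [:: b, c & s] erefl.
      by move=> e es; rewrite inE es orbT.
    have [|v2 v2D s2] := sub [:: a, c & s] erefl.
      by move=> e; rewrite !inE => /or3P[]->; rewrite ?orbT.
    have [|v3 v3D s3] := sub [:: a, b & s] erefl.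
      by move=> e; rewrite !inE => /or3P[]->; rewrite ?orbT.
    have [v vD vE] := closed_majority v1D v2D v3D; exists v => // e es.
    rewrite vE; last by apply: (inv_set_root (sw e es)).
    move: es (introT implyP (s1 e)) (introT implyP (s2 e)).
    move: (introT implyP (s3 e)).
    rewrite !in_cons /majority.
    case: (e == a); case: (e == b); case: (e == c); case: (e \in s) => //=;
      by case: (e \in N v1); case: (e \in N v2); case: (e \in N v3).
have [v vD wv] := agree (N w) (fun _ => id).
apply/D_closed/(nu_majority vD vD vD wW) => a /wv av.
by rewrite /majority av.
Qed.

End Closed.

(** * Connected ample domains *)

Section Connected.
Variable D : {fset 'M[R]_n}.
Hypothesis DW : forall w, w \in D -> coxeter_group Phi w.
Hypothesis D_ample : ample Phi Phip D.

(** Otherwise all members of [D] would invert [- a]. *)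
Lemma ample_not_le_opp a : a \in Phi -> ~~ ((- a) <=[D] a).
Proof.
move=> aP; apply/negP=> /(phi_le_oppl DW _ aP) aN; apply: D_ample.
exists (- a); first exact: root_opp.
by move=> v vD; rewrite (inv_setN (DW vD)) //; have := aN v vD; rewrite andbb.
Qed.

Hypothesis D_connected : connected_domain Phi Phip D.

(** By ampleness some member inverts [c] and some other does not; along a path
    between them, [c] is added at some step, and only one root is added then. *)
Lemma connected_flip c : c \in Phi -> exists u v,
  [/\ u \in D, v \in D, c \notin N u, c \in N v
    & forall a, a \in N v -> a != c -> a \in N u].
Proof.
move=> cP.
have [u uD cu] : exists2 u, u \in D & c \notin N u.
  apply: contrapT => none; apply: D_ample; exists c => // v vD.
  by apply: contraT => cv; case: none; exists v.
have [v vD cv] : exists2 v, v \in D & c \in N v.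
  apply: contrapT => none; apply: D_ample; exists (- c) => [|v vD].
    exact: root_opp.
  by rewrite (inv_setN (DW vD)) //; apply/negP=> cv; apply: none; exists v.
have [p [pD up pv]] := D_connected uD vD.
elim: p u uD cu pD up pv => [|y p IH] u uD cu pD /=.
  by move=> _ uv; rewrite uv cv in cu.
case/andP=> uy yp pv; have yD : y \in D by rewrite pD ?mem_head.
have [cy|cy] := boolP (c \in N y); last first.
  by apply: (IH y) => // e ep; rewrite pD // inE ep orbT.
exists u, y; split=> // a ay ac; apply: contraNT ac => au.
have /cardfs1P[z yuE] := uy.
have : a \in N y `\` N u by rewrite in_fsetD au ay.
have : c \in N y `\` N u by rewrite in_fsetD cu cy.
by rewrite yuE !inE => /eqP-> /eqP->.
Qed.

(** At the step where [a] is added, an equivalent root would be added too. *)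
Lemma connected_antisym a b : a \in Phi -> a <=[D] b -> b <=[D] a -> a = b.
Proof.
move=> aP /phi_leP ab /phi_leP ba; apply/eqP/contraT; rewrite eq_sym => ba'.
have [u [v [uD vD au av only]]] := connected_flip aP.
by rewrite (ab u uD (only b (ba v vD av) ba')) in au.
Qed.

(** At the step where [c] is added, [a] and [b] are already present, and so is
    [- c] before that step. *)
Lemma connected_no_triple_below a b c : root_triple Phi a b (- c) ->
  ~ (a <=[D] c /\ b <=[D] c).
Proof.
move=> abc [/phi_leP ac /phi_leP bc]; have [aP bP] := triple_roots abc.
rewrite (root_oppE Phi_root) => cP.
have [u [v [uD vD cu cv only]]] := connected_flip cP.
have ac' : a != c.
  have := triple_neq_opp Phi_root (triple_rot (triple_rot abc)).
  by rewrite eqr_opp eq_sym.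
have bc' : b != c.
  by have := triple_neq_opp Phi_root (triple_rot abc); rewrite opprK.
have au := only a (ac v vD cv) ac'; have bu := only b (bc v vD cv) bc'.
have := inv_set_no_triple (DW uD) abc au bu.
by rewrite (inv_setN (DW uD)) // cu.
Qed.

(** A set that is not an ideal already fails to be one at a cover, by refining
    [a <= b]; the difference in size of [dom_at] measures how far apart [a] and
    [b] are. *)
Lemma cover_separating J a b : a \in Phi -> b \in Phi -> a <=[D] b ->
  a \notin J -> b \in J -> exists a' b',
    [/\ phi_covers Phi Phip D a' b', a' \notin J & b' \in J].
Proof.
have [k] := ubnP (#|` dom_at Phi Phip D a| - #|` dom_at Phi Phip D b|)%N.
elim: k a b => // k IH a b; rewrite ltnS => abk aP bP ab aJ bJ.
have ab_lt : phi_lt Phi Phip D a b.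
  rewrite /phi_lt ab; apply: contra aJ => ba.
  by rewrite (connected_antisym aP ab ba).
have [[c cP /andP[ac cb]]|none] := pselect (exists2 c, c \in Phi &
    phi_lt Phi Phip D a c && phi_lt Phi Phip D c b); last first.
  by exists a, b; split.
have card_lt p q : phi_lt Phi Phip D p q ->
    (#|` dom_at Phi Phip D q| < #|` dom_at Phi Phip D p|)%N.
  by move=> pq; apply: fproper_ltn_card; rewrite /fproper.
have /card_lt ac_lt := ac; have /card_lt cb_lt := cb.
case/andP: ac => ac _; case/andP: cb => cb _.
have [cJ|cJ] := boolP (c \in J); [apply: (IH a c) | apply: (IH c b)] => //; lia.
Qed.

End Connected.

(** * Maximality and covers *)

Section Maximality.
Variable D : {fset 'M[R]_n}.
Hypothesis D_condorcet : condorcet Phi Phip D.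
Hypothesis D_connected : connected_domain Phi Phip D.
Hypothesis D_ample : ample Phi Phip D.

Let DW w : w \in D -> coxeter_group Phi w.
Proof. by case: D_condorcet => _ + _; apply. Qed.

Definition in_common_triple a b : Prop := exists c, root_triple Phi a (- b) c.

(** A larger Condorcet domain has a member violating a cover [a], [b].  In the
    triple [- a, b, - c] this rules out [a <= b] as the witnessing pair, and
    each of the other two pairs gives, in [D], two roots of a root-triple that
    are below the opposite of the third. *)
Lemma covers_in_triple_maximal : closed_domain Phi Phip D ->
  (forall a b, phi_covers Phi Phip D a b -> in_common_triple a b) ->
  maximal_condorcet Phi Phip D.
Proof.
move=> D_closed covers; split=> // -[E [E_condorcet /andP[DE]]].
case/fsubsetPn=> w wE; apply/negP; rewrite negbK.
have [_ EW Epair] := (condorcetP E).1 E_condorcet.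
apply: (closed_ideal D_condorcet D_closed) => [|a0 b0 a0P b0P ab0 bw0].
  exact: EW.
apply: contraT => aw0.
have [a [b [ab aw bw]]] :=
  cover_separating DW D_ample D_connected a0P b0P ab0 aw0 bw0.
have [c abc] := covers a b ab; have [aP nbP cP] := triple_roots abc.
have [_ bP /andP[ab_le _] _] := ab.
have := Epair _ _ _ (triple_opp Phi_root abc); rewrite !opprK.
case/or3P.
- by move/phi_leP/(_ w wE bw)/(negP aw).
- move/(phi_le_sub DE) => /(phi_le_opp DW aP (root_opp Phi_root cP)).
  rewrite opprK => ca; have := phi_le_opp DW aP bP ab_le => ba.
  apply: False_ind.
  apply: (connected_no_triple_below DW D_ample D_connected _ (conj ba ca)).
  by rewrite opprK; apply: triple_rot.
- move/(phi_le_sub DE) => /(phi_le_opp DW nbP (root_opp Phi_root cP)).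
  rewrite !opprK => cb; apply: False_ind.
  apply: (connected_no_triple_below DW D_ample D_connected _ (conj ab_le cb)).
  exact: triple_swap (triple_rot (triple_rot abc)).
Qed.

Section RemovedCover.
Variables p q : 'cV[R]_n.
Hypothesis pq_covers : phi_covers Phi Phip D p q.
Hypothesis pq_not_common : ~ in_common_triple p q.

Let pP : p \in Phi. Proof. by case: pq_covers. Qed.
Let qP : q \in Phi. Proof. by case: pq_covers. Qed.
Let pq_le : p <=[D] q. Proof. by case: pq_covers => _ _ /andP[]. Qed.
Let qp_nle : ~~ (q <=[D] p). Proof. by case: pq_covers => _ _ /andP[]. Qed.

(** Both pairs are removed, because [phi_le] is stable under the order-reversing
    map [(a, b) |-> (- b, - a)] and this symmetry has to be kept. *)
Definition reduced_le a b : bool :=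
  [&& a <=[D] b, (a, b) != (p, q) & (a, b) != (- q, - p)].

Lemma covers_neq : p != q.
Proof. by apply: contraNneq qp_nle => ->; apply: phi_le_refl. Qed.

Lemma covers_neq_opp : p != - q.
Proof.
by have := ample_not_le_opp DW D_ample qP; apply: contraNneq => <-.
Qed.

Lemma reduced_le_refl a : reduced_le a a.
Proof.
rewrite /reduced_le phi_le_refl !xpair_eqE /=.
apply/andP; split; apply/negP=> /andP[/eqP-> /eqP e].
  by have := covers_neq; rewrite e eqxx.
by have := covers_neq; rewrite -eqr_opp e eqxx.
Qed.

Lemma reduced_le_opp a b : a \in Phi -> b \in Phi ->
  reduced_le a b -> reduced_le (- b) (- a).
Proof.
move=> aP bP /and3P[ab ne1 ne2]; rewrite /reduced_le (phi_le_opp DW) //=.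
move: ne1 ne2; rewrite !xpair_eqE !eqr_opp !eqr_oppLR => ne1 ne2.
by rewrite ![(b == _) && _]andbC ne1 ne2.
Qed.

(** [phi_covers] only excludes roots strictly between [p] and [q]; antisymmetry
    identifies the others. *)
Lemma between_covers a : a \in Phi -> p <=[D] a -> a <=[D] q -> a = p \/ a = q.
Proof.
move=> aP pa aq; have [_ _ _ none] := pq_covers.
have [ap|ap] := boolP (a <=[D] p).
  by left; apply: (connected_antisym DW D_ample D_connected).
have [qa|qa] := boolP (q <=[D] a).
  by right; apply: (connected_antisym DW D_ample D_connected).
by case: none; exists a; rewrite // /phi_lt pa ap aq qa.
Qed.

(** No chain from [p] to [q] passes through a third root, so transitivity never
    produces the removed pair; the other one follows by symmetry. *)
Lemma reduced_le_trans b a c : a \in Phi -> b \in Phi -> c \in Phi ->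
  reduced_le a b -> reduced_le b c -> reduced_le a c.
Proof.
have avoid (x y z : 'cV[R]_n) : y \in Phi ->
    reduced_le x y -> reduced_le y z -> (x, z) != (p, q).
  move=> yP xy yz; apply/eqP=> -[xp zq]; move: xy yz; rewrite xp zq.
  case/and3P=> py ne1 _ /and3P[yq ne2 _].
  case: (between_covers yP py yq) => yE.
    by rewrite yE eqxx in ne2.
  by rewrite yE eqxx in ne1.
move=> aP bP cP ab bc; apply/and3P; split.
- case/and3P: ab => ab _ _; case/and3P: bc => bc _ _.
  exact: phi_le_trans ab bc.
- exact: avoid ab bc.
- have := avoid _ _ _ (root_opp Phi_root bP) (reduced_le_opp bP cP bc)
    (reduced_le_opp aP bP ab).
  by rewrite !xpair_eqE !eqr_oppLR andbC.
Qed.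

(** The pairs that witness the Condorcet property survive the removal, since the
    removed ones lie in no root-triple. *)
Lemma triple_reduced_le a b c : root_triple Phi a b c ->
  (- a) <=[D] b -> reduced_le (- a) b.
Proof.
move=> abc ab; rewrite /reduced_le ab /=; have nabc := triple_opp Phi_root abc.
apply/andP; split; apply/eqP=> -[ea eb]; apply: pq_not_common; exists (- c).
  by rewrite -ea -eb.
by apply: triple_swap; rewrite -ea -[p]opprK -eb.
Qed.

Definition generated_ideal : {fset 'cV[R]_n} :=
  [fset a in Phi | reduced_le a q || reduced_le a (- p)].

Lemma mem_generated_ideal (a : 'cV[R]_n) : a \in Phi ->
  (a \in generated_ideal) = reduced_le a q || reduced_le a (- p).
Proof. by move=> aP; rewrite !inE /= aP. Qed.

Lemma generated_ideal_down (a b : 'cV[R]_n) :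
  a \in Phi -> b \in Phi -> reduced_le a b ->
  b \in generated_ideal -> a \in generated_ideal.
Proof.
move=> aP bP ab; rewrite !mem_generated_ideal //.
have npP := root_opp Phi_root pP.
by case/orP=> /(reduced_le_trans aP bP _ ab) -> //; rewrite orbT.
Qed.

(** If [a] and [- a] were below the generators [q] and [- p], one of the
    relations [- q <= q], [p <= - p] and [p <= q] would follow, or its mirror
    image: the first two contradict ampleness, the last was removed. *)
Lemma generated_ideal_consistent (a : 'cV[R]_n) : a \in Phi ->
  a \in generated_ideal -> (- a : 'cV[R]_n) \notin generated_ideal.
Proof.
have npP := root_opp Phi_root pP; have nqP := root_opp Phi_root qP.
have no_pq : ~~ reduced_le p q by rewrite /reduced_le eqxx andbF.
have not_opp b : b \in Phi -> ~~ reduced_le (- b) b.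
  by move=> bP; apply: contra (ample_not_le_opp DW D_ample bP) => /and3P[].
move=> aP; have naP := root_opp Phi_root aP.
have flip (b : 'cV[R]_n) : b \in Phi -> reduced_le (- a) b -> reduced_le (- b) a.
  by move=> bP /(reduced_le_opp naP bP); rewrite opprK.
rewrite !mem_generated_ideal //; case/orP=> a_le; apply/negP=> /orP[] /flip.
- move=> /(_ qP) le_a.
  by have := not_opp q qP; rewrite (reduced_le_trans nqP aP qP le_a a_le).
- move=> /(_ npP); rewrite opprK => le_a.
  by have := no_pq; rewrite (reduced_le_trans pP aP qP le_a a_le).
- move=> /(_ qP) le_a; have := reduced_le_trans nqP aP npP le_a a_le.
  by rewrite /reduced_le eqxx !andbF.
- move=> /(_ npP) le_a; have := not_opp _ npP.
  by rewrite (reduced_le_trans _ aP npP le_a a_le) // opprK.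
Qed.

(** Roots on which the generated ideal does not decide are decided as in [N u];
    any member [u] of [D] will do, as [N u] is an ideal. *)
Definition completion u : {fset 'cV[R]_n} :=
  [fset a in Phi | (a \in generated_ideal) ||
                   ((a \in N u) && ((- a : 'cV[R]_n) \notin generated_ideal))].

Lemma mem_completion u (a : 'cV[R]_n) : a \in Phi ->
  (a \in completion u) = (a \in generated_ideal) ||
    ((a \in N u) && ((- a : 'cV[R]_n) \notin generated_ideal)).
Proof. by move=> aP; rewrite !inE /= aP. Qed.

Lemma completion_half u : u \in D -> half_system Phi (completion u).
Proof.
move=> uD; split=> [|a aP].
  by apply/fsubsetP=> a; rewrite !inE => /andP[].
have naP := root_opp Phi_root aP.
rewrite !mem_completion // opprK (inv_setN (DW uD)) //.
have := generated_ideal_consistent aP.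
case: (a \in generated_ideal) => [/(_ isT)/negPf->|_] /=; first by rewrite andbF.
by rewrite andbT; case: (_ \in generated_ideal); rewrite ?andbF ?andbT.
Qed.

Lemma completion_down u (a b : 'cV[R]_n) : u \in D -> a \in Phi -> b \in Phi ->
  reduced_le a b -> b \in completion u -> a \in completion u.
Proof.
move=> uD aP bP ab; rewrite !mem_completion //.
have naP := root_opp Phi_root aP; have nbP := root_opp Phi_root bP.
case/orP=> [/(generated_ideal_down aP bP ab)->//|/andP[bu nbK]].
have -> : a \in N u by case/and3P: ab => /phi_leP ab _ _; apply: ab.
rewrite /= (contra _ nbK) ?orbT //.
exact/(generated_ideal_down nbP naP)/reduced_le_opp.
Qed.

(** The completion contains [q] and not [p], so it is the inversion set of an
    element outside [D]; being an ideal for [reduced_le], it keeps one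
    witnessing pair in each root-triple, so this element can be added. *)
Lemma removed_cover_not_maximal : ~ maximal_condorcet Phi Phip D.
Proof.
case=> _; apply; have [D0 _ Dpair] := (condorcetP D).1 D_condorcet.
have /fset0Pn[u uD] := D0.
have Jhalf := completion_half uD; have [_ Jopp] := Jhalf.
have Jpair a b : a \in Phi -> b \in Phi -> reduced_le (- a) b ->
    b \in completion u -> (- a : 'cV[R]_n) \in completion u.
  by move=> aP bP; apply: completion_down => //; apply: root_opp.
have reduced_pair a b c : root_triple Phi a b c ->
    [|| reduced_le (- a) b, reduced_le (- a) c | reduced_le (- b) c].
  move=> abc; apply/or3P; case/or3P: (Dpair _ _ _ abc) => le.
  - by apply: Or31; apply: triple_reduced_le le; apply: abc.
  - apply: Or32; apply: triple_reduced_le le.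
    exact: triple_swap (triple_rot (triple_rot abc)).
  - by apply: Or33; apply: triple_reduced_le le; apply: triple_rot abc.
have Jfree : triple_free Phi (completion u).
  move=> a b c abc; have [aP bP cP] := triple_roots abc.
  apply/negP=> /and3P[aJ bJ cJ].
  case/or3P: (reduced_pair _ _ _ abc) => /Jpair.
  - by move=> /(_ aP bP bJ); rewrite Jopp // aJ.
  - by move=> /(_ aP cP cJ); rewrite Jopp // aJ.
  - by move=> /(_ bP cP cJ); rewrite Jopp // bJ.
have [w wW wJ] := half_inv_set Jhalf Jfree.
have npP := root_opp Phi_root pP.
have qw : q \in N w.
  by rewrite wJ mem_completion // mem_generated_ideal // reduced_le_refl.
have pw : p \notin N w.
  rewrite -(inv_setN wW) // wJ mem_completion // mem_generated_ideal //.
  by rewrite reduced_le_refl orbT.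
have wD : w \notin D.
  by apply: contra pw => wD; move/phi_leP: pq_le; apply.
exists (w |` D); split; last first.
  by rewrite fproperE fsubsetU1 /=; apply/fsubsetPn; exists w; rewrite ?fset1U1.
have EW v : v \in w |` D -> coxeter_group Phi v.
  by case/fset1UP=> [->|/DW].
apply/condorcetP; split=> //; first by apply/fset0Pn; exists w; rewrite fset1U1.
have extend a b : a \in Phi -> b \in Phi -> reduced_le (- a) b ->
    (- a) <=[w |` D] b.
  move=> aP bP ab; apply/phi_leP=> v /fset1UP[->|vD].
    by rewrite wJ; apply: Jpair.
  by case/and3P: ab => /phi_leP ab _ _; apply: ab.
move=> a b c abc; have [aP bP cP] := triple_roots abc.
by case/or3P: (reduced_pair _ _ _ abc) => /extend ->; rewrite ?orbT.
Qed.

End RemovedCover.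
End Maximality.
End Domains.

Theorem theorem1p7 (R : realType) (n : nat) (Phi Phip : {fset 'cV[R]_n})
    (D : {fset 'M[R]_n})
    (Phi_root : root_system Phi) (Phip_pos : positive_system Phi Phip)
    (D_condorcet : condorcet Phi Phip D)
    (D_connected : connected_domain Phi Phip D)
    (D_ample : ample Phi Phip D)
    (D_closed : closed_domain Phi Phip D) :
  maximal_condorcet Phi Phip D <->
  (forall a b : 'cV[R]_n, phi_covers Phi Phip D a b ->
     exists x y z : 'cV[R]_n,
       [/\ root_triple Phi x y z, a \in [:: x; y; z] & - b \in [:: x; y; z]]).
Proof.
split=> [D_max a b ab|covers].
  have [[c abc]|none] := pselect (in_common_triple Phi a b); last first.
    by case: (removed_cover_not_maximal Phi_root Phip_pos D_condorcet D_connected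
      D_ample ab none).
  by exists a, (- b), c; rewrite !inE !eqxx orbT.
apply: (covers_in_triple_maximal Phi_root Phip_pos) => // a b ab.
have [x [y [z [xyz ax bx]]]] := covers a b ab.
apply: triple_third xyz ax bx _.
exact: (covers_neq_opp Phi_root Phip_pos D_condorcet D_ample ab).
Qed.
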